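(* Let $G$ be a finite, undirected, simple, connected graph. Then $G$ is an $l^2$-convex geometry if and only if $G$ is a chordal $P_4$-free graph.
   Context: An induced path in $G$ is a path $x_0,\ldots,x_p$ of distinct vertices in which $x_i$ and $x_j$ are adjacent if and only if $|i-j|=1$; its length is $p$, the number of its edges. $P_4$ denotes the induced path on four vertices; $G$ is $P_4$-free if no induced subgraph of $G$ is isomorphic to $P_4$. $G$ is chordal if it contains no induced cycle with at least four vertices. Let $k\geq 2$ be an integer. A set $S\subseteq V(G)$ is $l^k$-convex if for every pair of vertices $x,y\in S$, every induced path of $G$ of length at most $k$ connecting $x$ and $y$ has all its vertices in $S$. (The empty set and $V(G)$ are $l^k$-convex.) The $l^k$-convex hull $\mathit{hull}_{l^k}(S)$ of $S\subseteq V(G)$ is the smallest $l^k$-convex set containing $S$, i.e. the intersection of all $l^k$-convex sets of $G$ containing $S$. A vertex $x$ of an $l^k$-convex set $S$ is an extreme point of $S$ if $S\setminus\{x\}$ is also $l^k$-convex; $\mathit{Ext}_{l^k}(S)$ denotes the set of all extreme points of $S$. The graph $G$ is an $l^k$-convex geometry if $\mathit{hull}_{l^k}(\mathit{Ext}_{l^k}(S))=S$ for every $l^k$-convex set $S$ of $G$. Here $k=2$. *)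

(* Defs.v *)
From mathcomp Require Export all_boot.

Set Implicit Arguments.
Unset Strict Implicit.
Unset Printing Implicit Defensive.

(* A finite simple graph is a symmetric irreflexive relation [e] on a finType:
   [e x y] means that [x] and [y] are adjacent. *)

Definition connected_graph (T : finType) (e : rel T) : Prop :=
  forall x y : T, connect e x y.

(* The vertices x_0, ..., x_p; the index [p] is the length (number of edges). *)
Definition induced_path (T : finType) (e : rel T) (p : nat)
    (x : {ffun 'I_p.+1 -> T}) : bool :=
  injectiveb x &&
  [forall i, forall j, e (x i) (x j) == ((i.+1 == j :> nat) || (j.+1 == i :> nat))].

(* [ordS] is the successor modulo [n]. The adjacency condition is the expected
   one for [n >= 3] only. *)
Definition induced_cycle (T : finType) (e : rel T) (n : nat)
    (x : {ffun 'I_n -> T}) : bool :=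
  injectiveb x &&
  [forall i, forall j, e (x i) (x j) == ((ordS i == j) || (ordS j == i))].

Definition chordal (T : finType) (e : rel T) : Prop :=
  forall (n : nat) (x : {ffun 'I_n -> T}), 4 <= n -> ~~ induced_cycle e x.

(* P_4 has four vertices, hence length 3. *)
Definition P4_free (T : finType) (e : rel T) : Prop :=
  forall x : {ffun 'I_4 -> T}, ~~ @induced_path T e 3 x.

Definition lk_convex (T : finType) (e : rel T) (k : nat) (S : {set T}) : bool :=
  [forall p : 'I_k.+1, forall x : {ffun 'I_p.+1 -> T},
    [&& induced_path e x, x ord0 \in S & x ord_max \in S] ==>
      [forall i, x i \in S]].

Definition lk_hull (T : finType) (e : rel T) (k : nat) (A : {set T}) : {set T} :=
  \bigcap_(S : {set T} | lk_convex e k S && (A \subset S)) S.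

(* Meant for [S] convex. *)
Definition lk_ext (T : finType) (e : rel T) (k : nat) (S : {set T}) : {set T} :=
  [set x in S | lk_convex e k (S :\ x)].

Definition lk_convex_geometry (T : finType) (e : rel T) (k : nat) : Prop :=
  forall S : {set T}, lk_convex e k S -> lk_hull e k (lk_ext e k S) = S.

(* Main.v *)
Require Import Defs.

(** Only induced paths with two edges constrain an [l^2]-convex set, so [S] is
    convex iff it contains the middle of every induced path on three vertices
    with both ends in [S], and an extreme point of a convex set [S] is a vertex
    whose neighbours in [S] are pairwise adjacent (a simplicial vertex of the
    subgraph induced on [S]).

    If the graph is a convex geometry, consider the hull of a set [A]; its
    extreme points all lie in [A] ([ext_hull_sub]). When [A] is an induced cycle
    of length at least 4, every vertex of [A] is the middle of an induced path
    inside [A], so the hull has no extreme point and would have to be empty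
    ([geometry_chordal]). When [A] is an induced path [a], [b], [c], [d], the
    extreme points are among [a] and [d]; these two vertices with their common
    neighbours form a convex set which misses [b] ([geometry_P4_free]).

    Conversely, without induced 4-cycles and [P_4], the closed neighbourhoods of
    adjacent vertices are nested ([nested_neighbourhoods]). Suppose that [x] in
    [S] has non-adjacent neighbours [u] and [z] in [S]. Among the neighbours of
    [x] in [S] that are neither [z] nor adjacent to [z], one whose closed
    neighbourhood in [S] is smallest is simplicial ([ext_neighbour]). Using this twice, first
    against [z] and then against the simplicial vertex just found, puts [x] in
    the middle of an induced path between two extreme points. *)

Set Implicit Arguments.
Unset Strict Implicit.
Unset Printing Implicit Defensive.

(** * Convexity and extreme points through induced paths on three vertices *)

Lemma injective_ffun_nth (T : eqType) n (x0 : T) (s : seq T) :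
  size s = n -> uniq s -> injective [ffun i : 'I_n => nth x0 s i].
Proof.
move=> size_s Us i j; rewrite !ffunE => /eqP.
by rewrite nth_uniq ?size_s // => /eqP/val_inj.
Qed.

Section TwoConvexity.

Variables (T : finType) (e : rel T).
Hypotheses (e_sym : symmetric e) (e_irr : irreflexive e).

Implicit Types (S A : {set T}) (a b c d u v x y z : T).

Definition midpoint a x b := [&& e a x, e x b, a != b & ~~ e a b].

Lemma midpoint_sym a x b : midpoint a x b = midpoint b x a.
Proof.
by rewrite /midpoint (e_sym a x) (e_sym x b) (e_sym a b) (eq_sym a b) andbCA.
Qed.

Lemma adj_neq x y : e x y -> x != y.
Proof. by apply: contraTneq => ->; rewrite e_irr. Qed.

Lemma l2_convexP S :
  reflect (forall a x b, a \in S -> b \in S -> midpoint a x b -> x \in S)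
          (lk_convex e 2 S).
Proof.
apply: (iffP forallP) => [cvxS a x b aS bS /and4P[ax xb ab nab] | midS].
  pose f := [ffun i : 'I_3 => nth a [:: a; x; b] i].
  have pathf : induced_path e f.
    apply/andP; split.
      apply/injectiveP/injective_ffun_nth => //=.
      by rewrite !inE !negb_or ab !adj_neq.
    apply/forallP => -[[|[|[|i]]] Hi] //; apply/forallP => -[[|[|[|j]]] Hj] //;
      rewrite !ffunE /= ?e_irr ?ax ?xb ?(negbTE nab) //;
      by rewrite e_sym ?ax ?xb ?(negbTE nab).
  have /forallP/(_ f)/implyP := cvxS ord_max.
  rewrite pathf !ffunE /= aS bS => /(_ isT)/forallP/(_ (Ordinal (isT : 1 < 3))).
  by rewrite ffunE.
case=> [[|[|[|p]]] Hp] //; apply/forallP => x; apply/implyP;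
  case/and3P => /andP[/injectiveP x_inj /forallP adjx] x0S xpS;
  apply/forallP => -[[|[|[|i]]] Hi] //=.
- by rewrite (_ : Ordinal _ = ord0) //; apply: val_inj.
- by rewrite (_ : Ordinal _ = ord0) //; apply: val_inj.
- by rewrite (_ : Ordinal _ = ord_max) //; apply: val_inj.
- by rewrite (_ : Ordinal _ = ord0) //; apply: val_inj.
- apply: midS x0S xpS _; rewrite /midpoint.
  do !rewrite (eqP (forallP (adjx _) _)) /=.
  by rewrite (inj_eq x_inj).
- by rewrite (_ : Ordinal _ = ord_max) //; apply: val_inj.
Qed.

(** Removing [x] from a convex set can only break convexity at an induced path
    with middle [x]. *)
Lemma l2_extP S x : lk_convex e 2 S ->
  reflect (x \in S /\ forall a b, a \in S -> b \in S -> ~~ midpoint a x b)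
          (x \in lk_ext e 2 S).
Proof.
move=> /l2_convexP cvxS; rewrite inE.
apply: (iffP andP) => -[xS ext_x]; split=> //.
  move=> a b aS bS; apply/negP => axb; have /and4P[ax xb _ _] := axb.
  have: x \in S :\ x.
    apply: (l2_convexP _ ext_x) (axb); rewrite !inE ?aS ?bS andbT.
      exact: adj_neq.
    by rewrite eq_sym adj_neq.
  by rewrite !inE eqxx.
apply/l2_convexP => a y b; rewrite !inE => /andP[_ aS] /andP[_ bS] ayb.
rewrite (cvxS _ _ _ aS bS ayb) andbT; apply: contraTneq ayb => ->.
exact: ext_x.
Qed.

End TwoConvexity.

(** * Convex hulls *)

Section Hull.

Variables (T : finType) (e : rel T) (k : nat).
Implicit Types (A S : {set T}) (x : T).

Lemma sub_hull A : A \subset lk_hull e k A.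
Proof. by apply/bigcapsP => S /andP[]. Qed.

Lemma hull_min A S : lk_convex e k S -> A \subset S -> lk_hull e k A \subset S.
Proof. by move=> cvxS sAS; apply: bigcap_inf; rewrite cvxS. Qed.

Lemma hull_convex A : lk_convex e k (lk_hull e k A).
Proof.
apply/forallP => p; apply/forallP => x; apply/implyP => /and3P[pathx x0 xp].
apply/forallP => i; apply/bigcapP => S /andP[cvxS sAS].
have hullS := subsetP (hull_min cvxS sAS).
have /forallP/(_ x)/implyP := forallP cvxS p.
by rewrite pathx (hullS _ x0) (hullS _ xp) => /(_ isT)/forallP.
Qed.

(** An extreme point [x] of the hull outside [A] would leave a smaller convex
    set containing [A]. *)
Lemma ext_hull_sub A : lk_ext e k (lk_hull e k A) \subset A.
Proof.
apply/subsetP => x; rewrite inE => /andP[xH cvxHx]; apply/negPn/negP => xA.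
have /subsetP/(_ x xH) : lk_hull e k A \subset lk_hull e k A :\ x.
  by apply: hull_min; rewrite // subsetD1 sub_hull.
by rewrite !inE eqxx.
Qed.

End Hull.

(** * Forbidden induced subgraphs on explicit vertices *)

Section Forbidden.

Variables (T : finType) (e : rel T).
Hypotheses (e_sym : symmetric e) (e_irr : irreflexive e).

Definition quad a b c d : {ffun 'I_4 -> T} :=
  [ffun i : 'I_4 => nth a [:: a; b; c; d] i].

Lemma chordal_no_C4 a b c d : chordal e ->
  e a b -> e b c -> e c d -> e d a -> a != c -> b != d -> e a c || e b d.
Proof.
move=> chE ab bc cd da ac bd; apply: contraNT (chE 4 (quad a b c d) isT).
rewrite negb_or => /andP[nac nbd]; apply/andP; split.
  apply/injectiveP/injective_ffun_nth => //=.
  by rewrite !inE !negb_or ac bd !(@adj_neq _ e) // e_sym.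
apply/forallP => -[[|[|[|[|i]]]] Hi] //;
  apply/forallP => -[[|[|[|[|j]]]] Hj] //; rewrite !ffunE /=;
  rewrite ?e_irr ?ab ?bc ?cd ?da ?(negbTE nac) ?(negbTE nbd) //;
  by rewrite e_sym ?ab ?bc ?cd ?da ?(negbTE nac) ?(negbTE nbd).
Qed.

Lemma P4_free_no_P4 a b c d : P4_free e ->
  e a b -> e b c -> e c d -> a != c -> b != d -> a != d ->
  [|| e a c, e b d | e a d].
Proof.
move=> p4E ab bc cd ac bd ad; apply: contraNT (p4E (quad a b c d)).
rewrite !negb_or => /and3P[nac nbd nad]; apply/andP; split.
  apply/injectiveP/injective_ffun_nth => //=.
  by rewrite !inE !negb_or ac bd ad !(@adj_neq _ e).
apply/forallP => -[[|[|[|[|i]]]] Hi] //;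
  apply/forallP => -[[|[|[|[|j]]]] Hj] //; rewrite !ffunE /=;
  rewrite ?e_irr ?ab ?bc ?cd ?(negbTE nac) ?(negbTE nbd) ?(negbTE nad) //;
  by rewrite e_sym ?ab ?bc ?cd ?(negbTE nac) ?(negbTE nbd) ?(negbTE nad).
Qed.

Lemma induced_P4_vertices (x : {ffun 'I_4 -> T}) : @induced_path T e 3 x ->
  exists a b c d, [/\ e a b, e b c, e c d & [&& a != c, b != d & a != d]]
    /\ [/\ ~~ e a c, ~~ e b d & ~~ e a d].
Proof.
case/andP => /injectiveP x_inj /forallP adjx.
exists (x (inord 0)), (x (inord 1)), (x (inord 2)), (x (inord 3)).
rewrite !(inj_eq x_inj) -!val_eqE.
by do !rewrite (eqP (forallP (adjx _) _)); rewrite /= !inordK.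
Qed.

Lemma iter_ordS n m (i : 'I_n) : iter m (@ordS n) i = (i + m) %% n :> nat.
Proof.
elim: m => [|m IHm] /=; first by rewrite addn0 modn_small.
by rewrite IHm -addn1 modnDml addn1 addnS.
Qed.

Lemma iter_ordS_neq n m (i : 'I_n) : 0 < m < n -> iter m (@ordS n) i != i.
Proof.
case/andP=> m0 mn; apply/negP => /eqP/(congr1 val).
rewrite /= iter_ordS => eq_im.
have /eqP : (i + m) %% n = (i + 0) %% n by rewrite eq_im addn0 modn_small.
by rewrite eqn_modDl mod0n modn_small // -leqn0 leqNgt m0.
Qed.

(** The ends are distinct and non-adjacent because going two or three steps
    around a cycle of length at least 4 does not return to the start. *)
Lemma cycle_midpoint n (x : {ffun 'I_n -> T}) j : 3 < n -> induced_cycle e x ->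
  midpoint e (x j) (x (ordS j)) (x (ordS (ordS j))).
Proof.
move=> n_gt3 /andP[/injectiveP x_inj /forallP adjx].
have neq m : 0 < m < 4 -> iter m (@ordS n) j != j.
  by case/andP=> m0 m4; rewrite iter_ordS_neq // m0 (leq_trans m4).
rewrite /midpoint (inj_eq x_inj) !(eqP (forallP (adjx _) _)) !eqxx /=.
rewrite (inj_eq (@ordS_inj _)) negb_or !(eq_sym j).
by rewrite (neq 1) ?(neq 2) ?(neq 3).
Qed.

End Forbidden.

(** * The characterization *)

Section Characterization.

Variables (T : finType) (e : rel T).
Hypotheses (e_sym : symmetric e) (e_irr : irreflexive e).

(** The hull of an induced cycle has no extreme point, although it is not the
    hull of the empty set. *)
Lemma geometry_chordal : lk_convex_geometry e 2 -> chordal e.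
Proof.
move=> geo n x n_gt3; apply/negP => cycx.
pose A := [set x i | i : 'I_n]; pose H := lk_hull e 2 A.
have cvxH : lk_convex e 2 H by exact: hull_convex.
have AH i : x i \in H by apply: (subsetP (sub_hull e 2 A)); apply: imset_f.
have ext0 : lk_ext e 2 H = set0.
  apply/setP => y; rewrite [RHS]inE; apply/negP => extHy.
  have /imsetP[i _ def_y] := subsetP (ext_hull_sub e 2 A) y extHy.
  have [_ ext_y] := l2_extP e_sym e_irr y cvxH extHy.
  have := cycle_midpoint (ord_pred i) n_gt3 cycx.
  by rewrite ord_predK -def_y; apply/negP/ext_y.
have cvx0 : lk_convex e 2 set0.
  by apply/l2_convexP => // a y b; rewrite inE.
have /subsetP/(_ (x (Ordinal n_gt3))) := hull_min cvx0 (sub0set set0).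
by rewrite -{1}ext0 geo // AH inE => /(_ isT).
Qed.

(** Two common neighbours [u], [v] of [a] and [d] are adjacent, since otherwise
    [a], [u], [d], [v] is an induced 4-cycle; hence [a], [d] is the only
    non-adjacent pair of this set. *)
Lemma pair_common_convex a d : chordal e -> a != d -> ~~ e a d ->
  lk_convex e 2 [set y | [|| y == a, y == d | e a y && e y d]].
Proof.
move=> chE ad nad; apply/l2_convexP => // u y v; rewrite !inE.
move=> uS vS /and4P[uy yv uv nuv].
case/or3P: uS uy uv nuv => [/eqP->|/eqP->|/andP[au ud]] uy uv nuv;
case/or3P: vS yv uv nuv => [/eqP->|/eqP->|/andP[av vd]] yv uv nuv.
- by rewrite eqxx in uv.
- by rewrite uy yv !orbT.
- by rewrite av in nuv.
- by rewrite (e_sym a) yv (e_sym y d) uy !orbT.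
- by rewrite eqxx in uv.
- by rewrite e_sym vd in nuv.
- by rewrite e_sym au in nuv.
- by rewrite ud in nuv.
have := chordal_no_C4 e_sym e_irr chE au ud (d := v).
rewrite (e_sym d v) (e_sym v a) vd av (negbTE nuv) (negbTE nad) ad uv.
by move/(_ isT isT isT isT).
Qed.

(** In the hull of an induced path [a], [b], [c], [d] only the ends can be
    extreme, but the ends together with their common neighbours are already
    convex, and [b], which is not adjacent to [d], is not among them. *)
Lemma geometry_P4_free : lk_convex_geometry e 2 -> P4_free e.
Proof.
move=> geo x; apply/negP => /induced_P4_vertices[a [b [c [d]]]].
case=> -[ab bc cd /and3P[ac bd ad]] [nac nbd nad].
have chE := geometry_chordal geo.
have cvxS := pair_common_convex chE ad nad; set S := [set y | _] in cvxS.
pose A := [set a; b; c; d]; pose H := lk_hull e 2 A.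
have AH : A \subset H by exact: sub_hull.
have cvxH : lk_convex e 2 H by exact: hull_convex.
have extS : lk_ext e 2 H \subset S.
  apply/subsetP => y extHy; have := subsetP (ext_hull_sub e 2 A) y extHy.
  have [_ ext_y] := l2_extP e_sym e_irr y cvxH extHy.
  have inH z : z \in A -> z \in H by exact: (subsetP AH).
  rewrite !inE -!orbA; case/or4P=> /eqP def_y; rewrite def_y ?eqxx ?orbT //.
    have := ext_y a c; rewrite def_y /midpoint ab bc ac nac.
    by rewrite !inH ?inE ?eqxx ?orbT // => /(_ isT isT).
  have := ext_y b d; rewrite def_y /midpoint bc cd bd nbd.
  by rewrite !inH ?inE ?eqxx ?orbT // => /(_ isT isT).
have /subsetP/(_ b) := hull_min cvxS extS.
rewrite geo // (subsetP AH) ?inE ?eqxx ?orbT // => /(_ isT).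
rewrite (negbTE bd) (negbTE nbd) andbF !orbF eq_sym.
by rewrite (negbTE (adj_neq e_irr ab)).
Qed.

Hypotheses (chE : chordal e) (p4E : P4_free e).

(** If neither closed neighbourhood contained the other, witnesses [p] and [q]
    would make [p], [u], [v], [q] an induced [P_4] or an induced 4-cycle,
    according to whether [p] and [q] are adjacent. The form chosen here is the
    one in which it is used: a private neighbour [p] of [u] forces every
    neighbour of [v] into the closed neighbourhood of [u]. *)
Lemma nested_neighbourhoods u v p q : e u v ->
  e u p -> p != v -> ~~ e v p -> e v q -> q != u -> e u q.
Proof.
move=> uv up pv nvp vq qu; apply/negPn/negP => nuq.
have pq : p != q by apply: contraNneq nvp => ->.
have := P4_free_no_P4 e_sym e_irr p4E _ uv vq pv _ pq.
rewrite e_sym up (e_sym p v) (negbTE nvp) (negbTE nuq) eq_sym qu.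
move=> /(_ isT isT) /= epq.
have := chordal_no_C4 e_sym e_irr chE uv vq.
move=> /(_ p); rewrite (e_sym q p) epq (e_sym p u) up (eq_sym u q) qu.
rewrite (eq_sym v p) pv (negbTE nuq) (negbTE nvp).
by move/(_ isT isT isT isT).
Qed.

(** Choose, among the candidates for [v] in [S], one whose closed neighbourhood
    in [S] has the fewest elements. If it had non-adjacent neighbours [p] and
    [q] in [S], then [p] would be a candidate with a strictly smaller closed
    neighbourhood. *)
Lemma ext_neighbour S x z u : lk_convex e 2 S -> z \in S -> u \in S ->
  midpoint e u x z ->
  exists2 v, v \in lk_ext e 2 S & midpoint e v x z.
Proof.
move=> cvxS zS uS uxz; pose P v := (v \in S) && midpoint e v x z.
pose deg v := #|[set w in S | (w == v) || e v w]|.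
have Pu : P u by rewrite /P uS.
case: (arg_minnP deg Pu) => {uS uxz Pu}{}u /andP[uS uxz] min_u.
have /and4P[ux xz uz nuz] := uxz.
exists u => //; apply/l2_extP => //; split=> // p q pS qS; apply/negP.
case/and4P => pu uq pq npq.
(* [q] is a neighbour of [u] outside the closed neighbourhood of [p], so the
   latter is contained in that of [u]. *)
have sub_up w : e p w -> w != u -> e u w.
  move=> pw wu; apply: (nested_neighbourhoods (v := p) (p := q)) => //.
  - by rewrite e_sym.
  - by rewrite eq_sym.
have npz : ~~ e p z by apply: contra nuz => pz; rewrite sub_up // eq_sym.
(* Likewise [z] shows that the closed neighbourhood of [u] is contained in that
   of [x]. *)
have px : e p x.
  have xp : p != x by apply: contraNneq npz => ->.
  rewrite e_sym; apply: (nested_neighbourhoods (v := u) (p := z)) => //.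
  - by rewrite e_sym.
  - by rewrite eq_sym.
  - by rewrite e_sym.
have pz : p != z by apply: contraNneq nuz => <-; rewrite e_sym.
have /min_u : P p by rewrite /P pS /midpoint px xz pz.
rewrite leqNgt => /negP[]; apply: proper_card; apply/properP; split.
  apply/subsetP => w; rewrite !inE => /andP[->] /=.
  case/predU1P => [->|pw]; first by rewrite (e_sym u) pu orbT.
  by case: eqVneq => //= wu; rewrite sub_up.
by exists q; rewrite !inE qS ?uq ?orbT // eq_sym (negbTE pq) (negbTE npq).
Qed.

Lemma chordal_P4_free_geometry : lk_convex_geometry e 2.
Proof.
move=> S cvxS; apply/eqP; rewrite eqEsubset hull_min //=; last first.
  by apply/subsetP => x; rewrite inE => /andP[].
apply/subsetP => x xS; set H := lk_hull e 2 _.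
have extH v : v \in lk_ext e 2 S -> v \in H by exact: (subsetP (sub_hull _ _ _)).
have [/existsP[a /existsP[b /and3P[aS bS axb]]] | no_mid] :=
  boolP [exists a, exists b, [&& a \in S, b \in S & midpoint e a x b]].
  have [u extu uxb] := ext_neighbour cvxS bS aS axb.
  have uS : u \in S by move: extu; rewrite inE => /andP[].
  have [v extv vxu] : exists2 v, v \in lk_ext e 2 S & midpoint e v x u.
    by apply: ext_neighbour bS _; rewrite // midpoint_sym.
  have /l2_convexP cvxH : lk_convex e 2 H by exact: hull_convex.
  by apply: cvxH vxu => //; exact: extH.
apply/extH/l2_extP => //; split=> // a b aS bS; apply: contraNN no_mid => axb.
by apply/existsP; exists a; apply/existsP; exists b; rewrite aS bS.
Qed.

End Characterization.

Theorem theorem1 (T : finType) (e : rel T)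
    (e_sym : symmetric e) (e_irr : irreflexive e)
    (e_conn : connected_graph e) :
  lk_convex_geometry e 2 <-> chordal e /\ P4_free e.
Proof.
split=> [geo | [chE p4E]]; last exact: chordal_P4_free_geometry.
by split; [apply: geometry_chordal | apply: geometry_P4_free].
Qed.
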